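(* Let $(S,\mathcal X,\mathrm{rk})$ be a combinatorial complex and let $\mathcal S=(s_0<s_1<\dots<s_L)$ be an encoder rank path in $\mathcal X$, with $n_r=|\mathcal X^r|$. Then the support ratios $\rho_i=n_{s_{i+1}}/n_{s_i}$ ($0\le i\le L-1$) and the bottleneck support ratio $\rho_{\mathrm{bot}}=n_{s_L}/n_{s_0}$ are determined by the cell counts of $\mathcal X$ and the chosen rank path. Moreover, let $d_0,d_L$ be positive integers and consider a no-skip, bottleneck-only linear autoencoder, i.e. a pair of linear maps $$\mathrm{Enc}: C^{s_0}(\mathcal X;\mathbb R^{d_0})\to C^{s_L}(\mathcal X;\mathbb R^{d_L}),\qquad \mathrm{Dec}: C^{s_L}(\mathcal X;\mathbb R^{d_L})\to C^{s_0}(\mathcal X;\mathbb R^{d_0}).$$ A necessary condition for exact reconstruction of arbitrary rank-$s_0$ cochains is $d_L\ge d_0/\rho_{\mathrm{bot}}$; that is, if $\mathrm{Dec}(\mathrm{Enc}(H))=H$ for all $H\in C^{s_0}(\mathcal X;\mathbb R^{d_0})$, then $d_L\ge d_0/\rho_{\mathrm{bot}}$.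
   Context: A combinatorial complex is a triple $(S,\mathcal X,\mathrm{rk})$ where $S$ is a finite nonempty set, $\mathcal X\subseteq 2^S\setminus\{\emptyset\}$ is a finite collection of nonempty subsets (called cells) containing every singleton $\{v\}$, $v\in S$, and $\mathrm{rk}:\mathcal X\to\mathbb Z_{\ge 0}$ satisfies $\mathrm{rk}(\{v\})=0$ for all $v\in S$ and $x\subseteq y\Rightarrow \mathrm{rk}(x)\le\mathrm{rk}(y)$. Write $\mathcal X^r=\{x\in\mathcal X:\mathrm{rk}(x)=r\}$, $n_r=|\mathcal X^r|$, and $\mathcal R(\mathcal X)=\{r\in\mathbb Z_{\ge0}:\mathcal X^r\ne\emptyset\}$ (the active ranks). An encoder rank path is a strictly increasing sequence $\mathcal S=(s_0<s_1<\dots<s_L)$ of active ranks; $s_L$ is the bottleneck rank. For an active rank $r$, the cochain space is $C^r(\mathcal X;\mathbb R^{d}):=\mathbb R^{n_r\times d}$, with rows indexed by the cells of $\mathcal X^r$. *)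

(* Defs.v *)
From mathcomp Require Import all_boot all_order all_algebra.
From mathcomp Require Import reals.

Set Implicit Arguments.
Unset Strict Implicit.
Unset Printing Implicit Defensive.

Import Order.TTheory GRing.Theory Num.Theory.

Local Open Scope ring_scope.

(* [cc_rk] is total on [{set S}]; only its values on cells are meaningful. *)
Record combinatorial_complex (S : finType) := CombinatorialComplex {
  cc_cells :> {set {set S}};
  cc_rk : {set S} -> nat;
  cc_carrier_nonempty : (0 < #|S|)%N;
  cc_cells_nonempty : set0 \notin cc_cells;
  cc_singletons : forall v : S, [set v] \in cc_cells;
  cc_rk_singleton : forall v : S, cc_rk [set v] = 0%N;
  cc_rk_mono : forall x y : {set S}, x \in cc_cells -> y \in cc_cells ->
    x \subset y -> (cc_rk x <= cc_rk y)%N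
}.

Definition rank_cells (S : finType) (X : combinatorial_complex S) (r : nat) :
  {set {set S}} := [set x in cc_cells X | cc_rk X x == r].

Definition cell_count (S : finType) (X : combinatorial_complex S) (r : nat) :
  nat := #|rank_cells X r|.

Definition active_rank (S : finType) (X : combinatorial_complex S) (r : nat) :
  Prop := rank_cells X r != set0.

Definition encoder_rank_path (S : finType) (X : combinatorial_complex S)
    (L : nat) (s : 'I_L.+1 -> nat) : Prop :=
  (forall i j : 'I_L.+1, (i < j)%N -> (s i < s j)%N) /\
  (forall i : 'I_L.+1, active_rank X (s i)).

(* For [i : 'I_L], [widen_ord (leqnSn L) i] and [lift ord0 i] are the elements
   of ['I_L.+1] with values [i] and [i.+1]. *)
Definition support_ratio (R : realType) (S : finType)
    (X : combinatorial_complex S) (L : nat) (s : 'I_L.+1 -> nat) (i : 'I_L) :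
  R :=
  (cell_count X (s (lift ord0 i)))%:R /
  (cell_count X (s (widen_ord (leqnSn L) i)))%:R.

Definition bottleneck_support_ratio (R : realType) (S : finType)
    (X : combinatorial_complex S) (L : nat) (s : 'I_L.+1 -> nat) : R :=
  (cell_count X (s ord_max))%:R / (cell_count X (s ord0))%:R.

(* Row [i : 'I_(cell_count X r)] belongs to the cell
   [enum_val i \in rank_cells X r]. *)
Notation cochain R X r d := 'M[R]_(cell_count X r, d).

(* Main.v *)
Require Import Defs.
From mathcomp Require Import all_boot all_order all_algebra.
From mathcomp Require Import reals.

Set Implicit Arguments.
Unset Strict Implicit.
Unset Printing Implicit Defensive.

Import Order.TTheory GRing.Theory Num.Theory.

Local Open Scope ring_scope.

(** Exact reconstruction makes [Dec] a left inverse of [Enc], so the bottleneck space has at least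
    the dimension of the input space: n_{s_0} d_0 <= n_{s_L} d_L ([linear_retract_leq]). Active
    ranks have positive cell counts, so dividing by n_{s_L} gives the bound. *)

(* In vectorized form [g \o f = id] reads [lin_mx f *m lin_mx g = 1%:M]. *)
Lemma linear_retract_leq (F : fieldType) (m n p q : nat)
    (f : {linear 'M[F]_(m, n) -> 'M[F]_(p, q)})
    (g : {linear 'M[F]_(p, q) -> 'M[F]_(m, n)}) :
  cancel f g -> (m * n <= p * q)%N.
Proof.
move=> fK; apply: (@mulmx1_min F _ _ (lin_mx f) (lin_mx g)).
(* Row i of the product is the i-th basis vector, reshaped to a matrix, sent through [f] then [g],
   and flattened again. *)
by apply/row_matrixP => i; rewrite rowE mulmxA !mul_rV_lin /= mxvecK fK vec_mxK rowE mulmx1.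
Qed.

Theorem proposition3p6 (R : realType) (S : finType)
    (X : combinatorial_complex S) (L : nat) (s : 'I_L.+1 -> nat)
    (hs : encoder_rank_path X s) :
  [/\ (* the denominators of the ratios do not vanish *)
      forall i : 'I_L.+1, (0 < cell_count X (s i))%N,
      (* the ratios depend only on the cell counts and the rank path *)
      forall (S' : finType) (X' : combinatorial_complex S'),
        encoder_rank_path X' s ->
        (forall r : nat, cell_count X' r = cell_count X r) ->
        (forall i : 'I_L, support_ratio R X' s i = support_ratio R X s i) /\
        bottleneck_support_ratio R X' s = bottleneck_support_ratio R X s
    & forall (d0 dL : nat), (0 < d0)%N -> (0 < dL)%N ->
      forall (Enc : {linear cochain R X (s ord0) d0 ->
                            cochain R X (s ord_max) dL})
             (Dec : {linear cochain R X (s ord_max) dL ->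
                            cochain R X (s ord0) d0}),
        (forall H : cochain R X (s ord0) d0, Dec (Enc H) = H) ->
        d0%:R / bottleneck_support_ratio R X s <= dL%:R].
Proof.
have [_ active_s] := hs.
have count_gt0 i : (0 < cell_count X (s i))%N by rewrite card_gt0; apply: active_s.
split=> // [S' X' _ eq_count|d0 dL _ _ Enc Dec EncK].
  by rewrite /bottleneck_support_ratio !eq_count; split=> // i;
     rewrite /support_ratio !eq_count.
(* Clearing n_{s_L} > 0 leaves the dimension inequality in the naturals. *)
rewrite /bottleneck_support_ratio invf_div mulrA ler_pdivrMr ?ltr0n //.
by rewrite -!natrM ler_nat mulnC [leqRHS]mulnC (linear_retract_leq EncK).
Qed.
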